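(* The maximum value of the local dimension of a finite poset $P$ whose ground set consists of an antichain $A$ together with $n$ other points is $\Theta(n/\log n)$. That is, there are constants $c,C>0$ such that every such poset $P$ (with $n\ge 2$) satisfies $\operatorname{ldim}(P)\le C\,n/\log n$, and for all sufficiently large $n$ there exists such a poset $P$ with $\operatorname{ldim}(P)\ge c\,n/\log n$.
   Context: Local dimension: a partial linear extension (ple) of a poset $P$ is a linear extension of a subposet; for a family $\mathcal{L}$ of ple's, $\mu(u,\mathcal{L})$ is the number of members containing $u$ and $\mu(\mathcal{L})=\max_u\mu(u,\mathcal{L})$; a non-empty family $\mathcal{L}$ is a local realizer if whenever $x\le y$ in $P$ some $L\in\mathcal{L}$ has $x\le y$ in $L$, and whenever $x\parallel y$ in $P$ some $L\in\mathcal{L}$ has $x>y$ in $L$; $\operatorname{ldim}(P)$ is the minimum of $\mu(\mathcal{L})$ over local realizers. *)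

(* Defs.v *)
From mathcomp Require Import all_boot all_order.
From mathcomp Require Import boolp.

Set Implicit Arguments.
Unset Strict Implicit.
Unset Printing Implicit Defensive.

Import Order.TTheory.

Local Open Scope order_scope.

Section LocalDimension.
Context {d : Order.disp_t} {P : finPOrderType d}.

Definition antichain (A : {set P}) : Prop :=
  {in A &, forall x y, x != y -> x >< y}.

(* A linear order on a subset of P is represented by the duplicate-free
   sequence listing its elements in increasing order. *)
Definition le_in (s : seq P) (x y : P) : bool :=
  [&& x \in s, y \in s & (index x s <= index y s)%N].

Definition lt_in (s : seq P) (x y : P) : bool :=
  [&& x \in s, y \in s & (index x s < index y s)%N].

(* The underlying subposet is the one induced on [set x in s]. *)
Definition ple (s : seq P) : Prop :=
  uniq s /\ {in s &, forall x y, x <= y -> le_in s x y}.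

Definition mult (u : P) (L : seq (seq P)) : nat := count (fun s => u \in s) L.

Definition mu (L : seq (seq P)) : nat := \max_(u : P) mult u L.

Definition local_realizer (L : seq (seq P)) : Prop :=
  [/\ L <> [::],
      {in L, forall s, ple s},
      forall x y : P, x <= y -> exists2 s, s \in L & le_in s x y
    & forall x y : P, x >< y -> exists2 s, s \in L & lt_in s y x].

(* Chains of at most two elements already give a local realizer. *)
Lemma local_realizer_exists : exists L, local_realizer L.
Proof.
pose chain2 (x y : P) := if x == y then [:: x] else [:: x; y].
pose L := [::] :: [seq chain2 p.1 p.2 | p <- enum {: P * P} & ~~ (p.2 < p.1)].
have memL x y : ~~ (y < x) -> chain2 x y \in L.
  move=> nyx; rewrite in_cons; apply/orP; right.
  by apply/mapP; exists (x, y); rewrite // mem_filter mem_enum andbT.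
exists L; split=> //.
- move=> s; rewrite in_cons => /orP[/eqP -> | /mapP[[x y]]]; first by split.
  rewrite mem_filter => /andP[/= nyx _] ->; rewrite /chain2.
  have [_|nxy] := eqVneq x y.
    by split=> // u v; rewrite /le_in !inE => /eqP -> /eqP ->; rewrite eqxx leqnn.
  split=> [|u v]; first by rewrite /= inE nxy.
  rewrite /le_in !inE => /orP[]/eqP -> /orP[]/eqP -> uv;
    rewrite /= ?eqxx ?orbT ?leqnn //=.
  by move: nyx; rewrite lt_neqAle eq_sym nxy uv.
- move=> x y xy; exists (chain2 x y); first by apply: memL; rewrite le_gtF.
  rewrite /chain2 /le_in; have [<-|nxy] := eqVneq x y; rewrite !inE !eqxx ?orbT //=.
  by rewrite eqxx.
- move=> x y xy; exists (chain2 y x).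
    by apply: memL; rewrite incomparable_ltF.
  have nyx : y != x by apply: contraNneq xy => ->; rewrite comparablexx.
  by rewrite /chain2 /lt_in (negPf nyx) !inE !eqxx orbT /= eqxx (negPf nyx).
Qed.

Lemma mu_realizer_exists :
  exists k, `[< exists2 L, local_realizer L & mu L = k >].
Proof.
by have [L HL] := local_realizer_exists; exists (mu L); apply/asboolP; exists L.
Qed.

End LocalDimension.

Definition ldim {d : Order.disp_t} (P : finPOrderType d) : nat :=
  ex_minn (@mu_realizer_exists d P).

(* Main.v *)
Require Import Defs.
From HB Require Import structures.
From mathcomp Require Import all_boot all_order all_algebra.
From mathcomp Require Import zify.
From mathcomp Require Import boolp reals exp.

Set Implicit Arguments.
Unset Strict Implicit.
Unset Printing Implicit Defensive.

Import Order.TTheory GRing.Theory Num.Theory.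

(* Upper bound: cut the n points outside A into about n/k chunks G of size at
   most k, with k about (log_2 n)/4.  Relative to G, a point of P has one of at
   most 4^k types (the points of G below it and those above it), and for each
   type two ple's suffice: the points X of that type placed as low, respectively
   as high, as possible among the points of G.  A point lies in two of these for
   every chunk not containing it, and in at most 2 * 4^k for its own chunk.
   Together with a linear extension of P and two opposite orders of A, this is a
   local realizer of multiplicity O(n/k + 4^k) = O(n / log n).

   Lower bound: take n minimal points and, above them, a point for each of the
   2^n subsets, related by membership.  If every point is in at most t ple's,
   then at most n * t ple's contain a minimal point, and a subset is determined
   by its at most n + 1 possible positions relative to the minimal points in
   the at most t ple's containing it.  Hence 2^n <= (n * t * (n + 1) + 1)^t, that
   is, t is at least of order n / log n. *)

(** * Counting and reversal in duplicate-free sequences *)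

Lemma count_uniq_leq (T : eqType) (a : pred T) (s r : seq T) :
  uniq s -> {in s, forall x, a x -> x \in r} -> (count a s <= size r)%N.
Proof.
move=> us sr; rewrite -size_filter; apply: uniq_leq_size; first exact: filter_uniq.
by move=> x; rewrite mem_filter => /andP[ax xs]; apply: sr.
Qed.

Lemma index_rev (T : eqType) (s : seq T) (x : T) :
  uniq s -> x \in s -> index x (rev s) = (size s - (index x s).+1)%N.
Proof.
move=> us xs; have lt_i : (index x s < size s)%N by rewrite index_mem.
have lt_j : (size s - (index x s).+1 < size s)%N by rewrite ltn_subrL (leq_ltn_trans _ lt_i).
have {1}-> : x = nth x (rev s) (size s - (index x s).+1).
  by rewrite nth_rev // subnSK // subKn ?nth_index // ltnW.
by rewrite index_uniq ?size_rev ?rev_uniq.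
Qed.

(** * Partial linear extensions and how to build them *)

Section PartialLinearExtensions.
Context {d : Order.disp_t} {P : finPOrderType d}.
Local Open Scope order_scope.
Implicit Types (x y z : P) (s : seq P) (X G : {set P}) (L : seq (seq P)).

Lemma ldim_leq_mu L : local_realizer L -> (ldim P <= mu L)%N.
Proof.
by rewrite /ldim; case: ex_minnP => m _ min_m HL; apply/min_m/asboolP; exists L.
Qed.

Lemma ldim_attained : exists2 L : seq (seq P), local_realizer L & mu L = ldim P.
Proof. by rewrite /ldim; case: ex_minnP => m /asboolP. Qed.

Lemma mult_leq_mu x L : (mult x L <= mu L)%N.
Proof. exact: (leq_bigmax_cond (F := fun u => mult u L)). Qed.

Definition below_card x y :=
  (#|[set z : P | z <= x]%O| <= #|[set z : P | z <= y]%O|)%N.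

Definition linext X : seq P := sort below_card (enum X).

Lemma mem_linext X x : (x \in linext X) = (x \in X).
Proof. by rewrite mem_sort mem_enum. Qed.

(** If [x <= y], the down-set of [x] lies inside that of [y]. Were [y] to come first, the sizes
    would force the two to coincide, so [x = y]. *)
Lemma ple_linext X : ple (linext X).
Proof.
have us : uniq (linext X) by rewrite sort_uniq enum_uniq.
have below_total : total below_card by move=> a b; apply: leq_total.
have below_trans : transitive below_card by move=> a b c; apply: leq_trans.
split=> // x y xs ys xy; rewrite /le_in xs ys leqNgt /=; apply/negP => yx.
have := sorted_ltn_index below_trans (sort_sorted below_total (enum X)) y x ys xs yx.
have sub : [set z | z <= x] \subset [set z | z <= y].
  by apply/subsetP => z; rewrite !inE => /le_trans; apply.
move=> dyx; have : y \in [set z | z <= x].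
  have /eqP -> : [set z | z <= x] == [set z | z <= y] by rewrite eqEcard sub.
  by rewrite inE.
rewrite inE => yx'; have exy : x = y by apply/le_anti; rewrite xy.
by rewrite exy ltnn in yx.
Qed.

Lemma ple_cat s1 s2 : ple s1 -> ple s2 ->
  {in s1 & s2, forall x y, ~~ (y <= x)} -> ple (s1 ++ s2).
Proof.
move=> [u1 le1] [u2 le2] le12; have dis x : x \in s1 -> x \in s2 -> False.
  by move=> x1 x2; move: (le12 x x x1 x2); rewrite lexx.
split=> [|x y].
  rewrite cat_uniq u1 u2 andbT; apply/hasPn => x x2; apply/negP => x1.
  exact: dis x1 x2.
rewrite !mem_cat => xs ys xy; rewrite /le_in !mem_cat xs ys !index_cat /=.
case: ifP xs => [x1 _|x1 /= x2]; case: ifP ys => [y1 _|y1 /= y2].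
- by case/and3P: (le1 x y x1 y1 xy).
- by rewrite ltnW // ltn_addr // index_mem.
- by move: (le12 y x y1 x2); rewrite xy.
- by rewrite leq_add2l; case/and3P: (le2 x y x2 y2 xy).
Qed.

Lemma lt_in_cat s1 s2 x y : uniq (s1 ++ s2) ->
  x \in s1 -> y \in s2 -> lt_in (s1 ++ s2) x y.
Proof.
rewrite cat_uniq => /and3P[_ /hasPn s21 _] x1 y2.
rewrite /lt_in !mem_cat x1 y2 orbT !index_cat x1 (negPf (s21 y y2)) /=.
by rewrite ltn_addr // index_mem.
Qed.

Lemma ple_antichain (A : {set P}) s :
  antichain A -> uniq s -> {subset s <= A} -> ple s.
Proof.
move=> acA us sA; split=> // x y xs ys xy.
have [-> | nxy] := eqVneq x y; first by rewrite /le_in ys leqnn.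
by have := acA x y (sA x xs) (sA y ys) nxy; rewrite /Order.comparable xy.
Qed.

(** * A set inserted as one run among the points of [G] *)

Definition block G X (Q : pred P) : seq P :=
  linext [set x in G :\: X | ~~ Q x] ++ linext X
    ++ linext [set x in G :\: X | Q x].

Lemma mem_block G X Q x : (x \in block G X Q) = (x \in X) || (x \in G).
Proof.
rewrite !mem_cat !mem_linext !inE.
by case: (Q x); case: (x \in X); case: (x \in G).
Qed.

(** Each hypothesis excludes backward relations between one pair of the three runs: upper with
    lower, [X] with lower, upper with [X]. *)
Lemma ple_block G X (Q : pred P) :
  {in G &, forall x y, x <= y -> Q x -> Q y} ->
  {in X & G :\: X, forall x y, x <= y -> Q y} ->
  {in X & G :\: X, forall x y, y <= x -> ~~ Q y} ->
  ple (block G X Q).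
Proof.
move=> upQ XQ QX; do 2?[apply: ple_cat; try exact: ple_linext].
- move=> x y; rewrite !mem_linext => xX; rewrite [in X in X -> _]inE => /andP[yG Qy].
  by apply/negP => /(QX x y xX yG); rewrite Qy.
- move=> x y; rewrite !mem_cat !mem_linext inE => /andP[xG nQx] yS.
  apply: contra nQx => yx; case/orP: yS => [yX | ]; first exact: XQ yX xG yx.
  rewrite inE => /andP[yG]; apply: upQ yx; by [case/setDP: xG | case/setDP: yG].
Qed.

(** * Types of points relative to a chunk [G] *)

Definition trace G x : {set P} * {set P} :=
  ([set z in G | z <= x], [set z in G | x <= z]).

(* A point of G is the only point of its type, so the blocks below also reverse
   the incomparable pairs inside G. *)
Definition twins G (tau : {set P} * {set P}) : {set P} :=
  [set x | trace G x == tau].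

(** [low] and [high] refer to the points of [G]: those incomparable to the twins precede them in
    [low_block] and follow them in [high_block]. *)
Definition low_block G tau : seq P :=
  block G (twins G tau) (fun x => [exists p in twins G tau, p <= x]).

Definition high_block G tau : seq P :=
  block G (twins G tau) (fun x => ~~ [exists p in twins G tau, x <= p]).

Lemma trace_le G x y z : trace G x = trace G y -> z \in G ->
  ((z <= x) = (z <= y)) * ((x <= z) = (y <= z)).
Proof. by move=> [/setP/(_ z) + /setP/(_ z)]; rewrite !inE => + + zG; rewrite zG. Qed.

Lemma twinsP G tau x y : x \in twins G tau -> y \in twins G tau ->
  trace G x = trace G y.
Proof. by rewrite !inE => /eqP-> /eqP->. Qed.

(** As [x] lies in [G], its trace records its comparison with itself, and equal traces pass both
    inequalities on to [y]. *)
Lemma twins_eq G tau x y : x \in twins G tau -> y \in twins G tau ->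
  x \in G -> x = y.
Proof.
move=> xX yX xG; have := trace_le (twinsP xX yX) xG; rewrite lexx => -[h1 h2].
by apply/le_anti; rewrite -h1 -h2.
Qed.

(** Twins compare alike with every point of [G]. So a point of [G] above one twin and below another
    is above and below the same one, hence a twin itself. *)
Lemma ple_low_block G tau : ple (low_block G tau).
Proof.
apply: ple_block => [x y xG yG xy|x y xX _ xy|x y xX /setDP[yG nyX] yx].
- case/exists_inP => p pX px; apply/exists_inP; exists p => //; exact: le_trans xy.
- by apply/exists_inP; exists x.
- apply: contra nyX => /exists_inP[p pX]; rewrite (trace_le (twinsP pX xX) yG) => xy.
  by have /le_anti -> : y <= x <= y by rewrite yx.
Qed.

Lemma ple_high_block G tau : ple (high_block G tau).
Proof.
apply: ple_block => [x y xG yG xy|x y xX /setDP[yG nyX] xy|x y xX _ yx].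
- apply: contra => /exists_inP[p pX yp]; apply/exists_inP; exists p => //.
  exact: le_trans xy _.
- apply: contra nyX => /exists_inP[p pX]; rewrite (trace_le (twinsP pX xX) yG) => yx.
  by have /le_anti -> : y <= x <= y by rewrite yx.
- by rewrite negbK; apply/exists_inP; exists x.
Qed.

Lemma twins_trace G x : x \in twins G (trace G x).
Proof. by rewrite inE. Qed.

Lemma incomparable_twins G x y : x \in G -> x >< y ->
  x \notin twins G (trace G y).
Proof.
by move=> xG; apply: contra => xX; rewrite (twins_eq xX (twins_trace G y) xG) comparablexx.
Qed.

Lemma lt_low_block G x y : x \in G -> x >< y ->
  lt_in (low_block G (trace G y)) x y.
Proof.
move=> xG nxy; have nX := incomparable_twins xG nxy; have yX := twins_trace G y.
apply: lt_in_cat; first by case: (ple_low_block G (trace G y)).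
  rewrite mem_linext inE in_setD nX xG /=; apply: contra nxy.
  move=> /exists_inP[p pX]; rewrite (trace_le (twinsP pX yX) xG) => yx.
  by rewrite comparable_sym /Order.comparable yx.
by rewrite mem_cat mem_linext yX.
Qed.

Lemma lt_high_block G x y : x \in G -> x >< y ->
  lt_in (high_block G (trace G y)) y x.
Proof.
move=> xG nxy; have nX := incomparable_twins xG nxy; have yX := twins_trace G y.
rewrite /high_block /block catA; apply: lt_in_cat.
- by rewrite -catA; case: (ple_high_block G (trace G y)).
- by rewrite mem_cat !mem_linext yX orbT.
rewrite mem_linext inE in_setD nX xG /=; apply: contra nxy.
move=> /exists_inP[p pX]; rewrite (trace_le (twinsP pX yX) xG) => yx.
by rewrite /Order.comparable yx.
Qed.

Definition traces G : {set {set P} * {set P}} := setX (powerset G) (powerset G).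

Lemma trace_traces G x : trace G x \in traces G.
Proof. by rewrite in_setX !powersetE; apply/andP; split; apply/subsetP => z /[!inE]/andP[]. Qed.

Lemma card_traces G : #|traces G| = (4 ^ #|G|)%N.
Proof. by rewrite cardsX card_powerset -expnMn. Qed.

(** A point outside [G] enters a block only as a twin, hence only the block of its own trace. *)
Lemma count_block_traces G u (Q : {set P} * {set P} -> pred P) :
  (count (fun tau => u \in block G (twins G tau) (Q tau)) (enum (traces G))
   <= if u \in G then 4 ^ #|G| else 1)%N.
Proof.
case: ifP => uG.
  by rewrite -card_traces cardE; apply: count_size.
apply: (count_uniq_leq (r := [:: trace G u])); first exact: enum_uniq.
by move=> tau _; rewrite mem_block uG orbF !inE eq_sym.
Qed.

Definition blocks G : seq (seq P) :=
  [seq low_block G tau | tau <- enum (traces G)]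
    ++ [seq high_block G tau | tau <- enum (traces G)].

(** The exponential term is kept apart because, summed over disjoint chunks, it contributes at most
    once. *)
Lemma mult_blocks G u : (mult u (blocks G) <= 2 * (1 + (u \in G) * 4 ^ #|G|))%N.
Proof.
rewrite /mult count_cat !count_map mul2n -addnn.
have c : ((if u \in G then 4 ^ #|G| else 1) <= 1 + (u \in G) * 4 ^ #|G|)%N.
  by case: ifP => _; rewrite ?mul1n ?leq_addl ?addn0.
by apply: leq_add; apply: leq_trans c; apply: count_block_traces.
Qed.

Lemma ple_blocks G : {in blocks G, forall s, ple s}.
Proof.
move=> s; rewrite mem_cat => /orP[] /mapP[tau _ ->].
  exact: ple_low_block.
exact: ple_high_block.
Qed.

Lemma lt_blocks G x y : x >< y -> (x \in G) || (y \in G) ->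
  exists2 s, s \in blocks G & lt_in s y x.
Proof.
move=> nxy /orP[xG | yG].
  exists (high_block G (trace G y)); last exact: lt_high_block.
  by rewrite mem_cat orbC map_f // mem_enum trace_traces.
exists (low_block G (trace G x)); last by apply: lt_low_block; rewrite // comparable_sym.
by rewrite mem_cat map_f // mem_enum trace_traces.
Qed.

(** * Splitting the points outside [A] into chunks *)

Definition chunk (A : {set P}) k g : {set P} :=
  [set x in ~: A | (index x (enum (~: A)) %/ k)%N == g].

Lemma card_chunk A k g : (0 < k -> #|chunk A k g| <= k)%N.
Proof.
move=> k_gt0; rewrite -[leqRHS](size_iota (g * k)%N) cardE.
rewrite -(size_map (fun x => index x (enum (~: A)))); apply: uniq_leq_size.
  rewrite map_inj_in_uniq ?enum_uniq // => x y.
  rewrite !mem_enum !inE => /andP[xA _] /andP[yA _] exy.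
  by apply: (index_inj x (s := enum (~: A))); rewrite // mem_enum inE.
move=> i /mapP[x]; rewrite mem_enum inE => /andP[_ /eqP <-] ->.
by rewrite mem_iota leq_divM addnC -mulSn ltn_ceil.
Qed.

(** The 3 pays for a linear extension of [P] and two opposite orders of [A]; each of the
    [(#|~: A| %/ k).+1] chunks costs 2, and the chunk containing the point at most [2 * 4 ^ k]
    more. *)
Lemma ldim_antichain_add (A : {set P}) k : antichain A -> (0 < k)%N ->
  (ldim P <= 3 + 2 * (#|~: A| %/ k).+1 + 2 * 4 ^ k)%N.
Proof.
move=> acA k_gt0; set q := (_ %/ k)%N.
pose Bs := flatten [seq blocks (chunk A k g) | g <- iota 0 q.+1].
pose L := [:: linext setT, enum A, rev (enum A) & Bs].
have ltBs x y : x >< y -> (x \notin A) || (y \notin A) ->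
    exists2 s, s \in Bs & lt_in s y x.
  move=> nxy; rewrite -!in_setC => nA.
  have memBs z : z \in ~: A -> (z \in chunk A k (index z (enum (~: A)) %/ k)%N)
      /\ (index z (enum (~: A)) %/ k)%N \in iota 0 q.+1.
    move=> zA; split; first by rewrite inE zA eqxx.
    by rewrite mem_iota ltnS leq_div2r // cardE index_size.
  have [g gq xyg] : exists2 g, g \in iota 0 q.+1 & (x \in chunk A k g) || (y \in chunk A k g).
    case/orP: nA => /memBs[zg gq].
      by exists (index x (enum (~: A)) %/ k)%N; rewrite ?zg.
    by exists (index y (enum (~: A)) %/ k)%N; rewrite ?zg ?orbT.
  have [s sB sxy] := lt_blocks nxy xyg; exists s => //.
  by apply/flatten_mapP; exists g.
have HL : local_realizer L.
  split=> //.
  - move=> s; rewrite !inE => /or4P[/eqP->|/eqP->|/eqP->|].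
    + exact: ple_linext.
    + apply: (ple_antichain acA); first exact: enum_uniq.
      by move=> x; rewrite mem_enum.
    + apply: (ple_antichain acA); first by rewrite rev_uniq enum_uniq.
      by move=> x; rewrite mem_rev mem_enum.
    + by case/flatten_mapP => g _; apply: ple_blocks.
  - move=> x y xy; exists (linext setT); first by rewrite mem_head.
    by case: (ple_linext setT) => _; apply; rewrite ?mem_linext ?inE.
  - move=> x y nxy; case nA: ((x \notin A) || (y \notin A)).
      have [s sB sxy] := ltBs x y nxy nA; exists s => //.
      by rewrite !inE sB !orbT.
    (* Both points lie in [A], so one of its two opposite orders puts [y] before [x]. *)
    move: nA => /norP; rewrite !negbK => -[xA yA].
    have [xy|] := ltnP (index y (enum A)) (index x (enum A)).
      by exists (enum A); rewrite ?inE ?eqxx ?orbT // /lt_in !mem_enum xA yA.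
    rewrite leq_eqVlt => /orP[/eqP exy|yx].
      by move: nxy; rewrite (index_inj x _ _ exy) ?mem_enum ?comparablexx.
    exists (rev (enum A)); first by rewrite !inE eqxx !orbT.
    rewrite /lt_in !mem_rev !mem_enum xA yA /=.
    rewrite !index_rev ?enum_uniq ?mem_enum //.
    by rewrite ltn_sub2l ?ltnS // (leq_ltn_trans yx) // index_mem mem_enum.
apply: leq_trans (ldim_leq_mu HL) _; apply/bigmax_leqP => u _.
suff Bsu : (mult u Bs <= 2 * q.+1 + 2 * 4 ^ k)%N.
  rewrite -addnA (leq_trans _ (leq_add (leqnn 3) Bsu)) // /mult /= !addnA leq_add2r.
  by case: (u \in _); case: (u \in _); case: (u \in _).
rewrite /mult count_flatten -map_comp sumnE big_map.
move: (iota 0 q.+1) (size_iota 0 q.+1) (iota_uniq 0 q.+1) => r size_r uniq_r.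
apply: leq_trans (leq_sum _ (fun g _ => mult_blocks (chunk A k g) u)) _.
rewrite -big_distrr -mulnDr leq_mul2l /= big_split /= sum1_size size_r leq_add2l.
have cg g : ((u \in chunk A k g) * 4 ^ #|chunk A k g| <= (u \in chunk A k g) * 4 ^ k)%N.
  by rewrite leq_mul2l leq_exp2l // card_chunk // orbT.
apply: leq_trans (leq_sum _ (fun g _ => cg g)) _.
rewrite -big_distrl /= -[leqRHS]mul1n leq_mul2r.
have -> : (\sum_(g <- r) (u \in chunk A k g)
           = count (fun g => u \in chunk A k g) r)%N.
  by rewrite -sumn_count sumnE big_map.
(* The position of [u] determines its chunk, so at most one [g] is counted. *)
rewrite (count_uniq_leq (r := [:: index u (enum (~: A)) %/ k]%N)) ?orbT ?uniq_r //.
by move=> g _; rewrite inE => /andP[_ /eqP <-]; rewrite mem_head.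
Qed.

End PartialLinearExtensions.

(** * Counting down-traces through a local realizer *)

Section DownTraces.
Context {d : Order.disp_t} {P : finPOrderType d}.
Local Open Scope order_scope.
Implicit Types (x y b : P) (s : seq P) (B : {set P}) (L : seq (seq P)).

(** The [.+1] counts [x] itself when it is in [B]; hence the height rises strictly on reaching a
    point of [B], as [lt_in_height] requires. *)
Definition height B s x : nat := count (mem B) (take (index x s).+1 s).

Lemma height_le_card B s x : uniq s -> (height B s x <= #|B|)%N.
Proof.
move=> us; rewrite cardE; apply: count_uniq_leq; first exact: take_uniq.
by move=> y _ yB; rewrite mem_enum.
Qed.

Lemma height_leq B s x y :
  (index x s <= index y s)%N -> (height B s x <= height B s y)%N.
Proof.
rewrite -ltnS => xy; rewrite /height -(take_takel s xy).
exact/leq_count_subseq/take_subseq.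
Qed.

Lemma lt_in_height B s x b : x \in s -> b \in s -> b \in B ->
  lt_in s x b = (height B s x < height B s b)%N.
Proof.
move=> xs bs bB; rewrite /lt_in xs bs /=; apply/idP/idP => [xb|]; last first.
  by apply: contraLR; rewrite -!leqNgt; apply: height_leq.
rewrite [X in (_ < X)%N]/height (take_nth b) ?index_mem // nth_index // -cats1.
rewrite count_cat /= bB addn1 ltnS /height -(take_takel s xb).
exact/leq_count_subseq/take_subseq.
Qed.

(** No ple puts [x] before [b] when [b <= x]. Otherwise [x < b] or the two are incomparable, and the
    matching clause of a local realizer supplies [s]. *)
Lemma lt_in_local_realizer L x b : local_realizer L -> x != b ->
  (exists2 s, s \in L & lt_in s x b) <-> ~~ (b <= x).
Proof.
move=> [_ pleL leL ltL] nxb; split=> [[s sL /and3P[xs bs xb]] | nbx].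
  apply/negP => bx; have [_ /(_ b x bs xs bx)] := pleL s sL.
  by rewrite /le_in leqNgt xb !andbF.
have [xb | bxi] := boolP (x <= b); last first.
  by apply: ltL; rewrite /Order.comparable negb_or nbx.
have [s sL /and3P[xs bs xlb]] := leL x b xb; exists s => //.
rewrite /lt_in xs bs ltn_neqAle xlb andbT; apply: contra nxb => /eqP.
by move=> e; apply/eqP/(index_inj x xs bs e).
Qed.

(** Double counting of the pairs formed by a point of [B] and a member of [L] containing it. *)
Lemma size_has_leq L B :
  (size [seq s <- L | has (mem B) s] <= #|B| * mu L)%N.
Proof.
rewrite size_filter -sumn_count sumnE big_map.
apply: (@leq_trans (\sum_(s <- L) \sum_(b in B) (b \in s))%N).
  apply: leq_sum => s _; case: hasP => // -[b bs bB].
  by rewrite (bigD1 b) //= bs.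
rewrite exchange_big /= -sum_nat_const; apply: leq_sum => b _.
rewrite (leq_trans _ (mult_leq_mu b L)) // /mult -sumn_count sumnE big_map.
exact: leqnn.
Qed.

(* The down-trace of x on B can be read off from the heights of x in the at most
   mu L sequences of L that contain x and meet B. *)
Lemma card_down_traces L B : local_realizer L ->
  (#|[set [set b in B | (b <= x)%O] | x : P]|
     <= (#|B| * mu L * #|B|.+1).+1 ^ mu L)%N.
Proof.
move=> HL; have [_ pleL _ _] := HL.
pose L' := [seq s <- L | has (mem B) s]; pose m := size L'.
pose t := mu L; pose N := #|B|.+1.
pose items x := [seq Some (j, inord (height B (nth [::] L' j) x) : 'I_N)
                | j : 'I_m <- enum 'I_m & x \in nth [::] L' j].
have size_items x : (size (items x) <= t)%N.
  rewrite size_map size_filter; apply: leq_trans (mult_leq_mu x L).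
  rewrite -(count_map (fun j : 'I_m => nth [::] L' j) (fun s => x \in s)).
  have -> : [seq nth [::] L' i | i : 'I_m <- enum 'I_m] = L'.
    by rewrite (map_comp (nth [::] L') (@nat_of_ord m)) val_enum_ord map_nth_iota0 // take_size.
  by rewrite /mult /L' count_filter; apply: sub_count => s /andP[].
(* Padding with [None] gives all codes length [t]; this extra symbol is the outer [.+1] in the base
   of the bound. *)
have size_code x : size (items x ++ nseq (t - size (items x)) None) == t.
  by rewrite size_cat size_nseq subnKC.
pose code x := Tuple (size_code x).
(* A point of [B] is in the down-trace unless some entry shows it strictly above [x]. *)
pose above b (o : option ('I_m * 'I_N)) := if o is Some (j, p)
  then (b \in nth [::] L' j) && (p < height B (nth [::] L' j) b)%N else false.
pose decode (c : t.-tuple _) := [set b in B | ~~ has (above b) c].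
have decodeK x : [set b in B | (b <= x)%O] = decode (code x).
  apply/setP => b; rewrite !inE; case bB: (b \in B) => //=.
  have -> : has (above b) (items x ++ nseq (t - size (items x)) None) = has (above b) (items x).
    by rewrite has_cat has_nseq andbF orbF.
  have memL' j : (j < m)%N -> nth [::] L' j \in L.
    by move=> jm; have := mem_nth [::] jm; rewrite mem_filter => /andP[].
  have itemsE : has (above b) (items x) <-> exists2 s, s \in L & lt_in s x b.
    split=> [/hasP[o /mapP[j]]|[s sL xb]].
      rewrite mem_filter => /andP[xs _] -> /= /andP[bs].
      have [us _] := pleL _ (memL' _ (ltn_ord j)).
      rewrite inordK ?ltnS ?height_le_card // -lt_in_height // => xb.
      by exists (nth [::] L' j); first exact: memL'.
    have /and3P[xs bs _] := xb; have [us _] := pleL _ sL.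
    have sL' : s \in L' by rewrite mem_filter sL andbT; apply/hasP; exists b.
    have jm : (index s L' < m)%N by rewrite index_mem.
    apply/hasP; exists (Some (Ordinal jm, inord (height B s x))).
      apply/mapP; exists (Ordinal jm); last by rewrite /= nth_index.
      by rewrite mem_filter mem_enum /= nth_index ?xs.
    by rewrite /= nth_index // bs inordK ?ltnS ?height_le_card // -lt_in_height.
  (* The case [x = b] is apart: no sequence puts a point strictly above itself, so decoding keeps
     it. *)
  have [exb|nxb] := eqVneq x b.
    rewrite {1}exb lexx; symmetry; apply/negP => h; have [s _] := itemsE.1 h.
    by rewrite exb /lt_in ltnn !andbF.
  have h : has (above b) (items x) = ~~ (b <= x)%O.
    have := lt_in_local_realizer HL nxb.
    by rewrite -itemsE => h; apply/idP/idP => /h.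
  by rewrite h negbK.
have -> : [set [set b in B | (b <= x)%O] | x : P] = [set decode c | c in [set code x | x : P]].
  by rewrite -imset_comp; apply: eq_imset => x; rewrite decodeK.
apply: leq_trans (leq_imset_card _ _) _; apply: leq_trans (max_card _) _.
rewrite card_tuple card_option card_prod !card_ord -/t.
case: (posnP t) => [-> //|t_gt0]; rewrite leq_exp2r // ltnS leq_mul2r.
by rewrite /m /L' size_has_leq orbT.
Qed.
End DownTraces.

(** * The poset of points and subsets related by membership *)

Definition membership (n : nat) : Type := ('I_n + {set 'I_n})%type.

HB.instance Definition _ n := Finite.copy (membership n) ('I_n + {set 'I_n})%type.

Definition membership_le n (x y : membership n) : bool :=
  match x, y with
  | inl i, inr X => i \in X
  | _, _ => x == y
  end.

Lemma membership_le_refl n : reflexive (@membership_le n).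
Proof. by case=> x /=. Qed.

Lemma membership_le_anti n : antisymmetric (@membership_le n).
Proof. by case=> [i|X] [j|T] /=; rewrite ?andbF // => /andP[/eqP]. Qed.

Lemma membership_le_trans n : transitive (@membership_le n).
Proof. by case=> [i|X] [j|T] [k|U] //=; try (by move=> /eqP[->]); move=> + /eqP[<-]. Qed.

HB.instance Definition _ n := Order.Le_isPOrder.Build (Order.Disp tt tt)
  (membership n) (@membership_le_refl n) (@membership_le_anti n)
  (@membership_le_trans n).

Definition set_points n : {set membership n} := [set inr X | X : {set 'I_n}].

Lemma antichain_set_points n : antichain (set_points n).
Proof.
move=> x y /imsetP[X _ ->] /imsetP[T _ ->] nXT.
rewrite /Order.comparable negb_or.
by apply/andP; split; [exact: nXT | rewrite eq_sym in nXT].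
Qed.

Lemma setC_set_points n : ~: set_points n = [set inl i | i : 'I_n].
Proof.
apply/setP => -[i|X]; rewrite !inE.
  rewrite imset_f //; apply/negP => /imsetP[X _ //].
rewrite imset_f //; symmetry; apply/negP => /imsetP[i _ //].
Qed.

Lemma card_setC_set_points n : #|~: set_points n| = n.
Proof. by rewrite setC_set_points card_imset ?card_ord // => i j []. Qed.

(** The down-trace of [inr X] is the copy of [X] among the minimal points, so every subset of them
    occurs. *)
Lemma card_membership_traces n :
  (2 ^ n <= #|[set [set b in ~: set_points n | (b <= x)%O] | x : membership n]|)%N.
Proof.
have inj : injective (fun X : {set 'I_n} => [set (inl i : membership n) | i in X]).
  by apply: imset_inj => i j [].
rewrite -[X in (2 ^ X <= _)%N](card_ord n) -cardsT -card_powerset -(card_imset _ inj).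
apply/subset_leq_card/subsetP => T /imsetP[X _ ->].
apply/imsetP; exists (inr X) => //; rewrite setC_set_points.
apply/setP => -[i|U]; rewrite !inE.
  by rewrite !mem_imset //; move=> ? ? [].
rewrite [X in _ = X && _](_ : _ = false); last by apply/negP => /imsetP[i _ //].
by apply/negP => /imsetP[i _ //].
Qed.

Lemma ldim_membership n : (2 <= n)%N -> (2 ^ n <= n ^ (3 * ldim (membership n)))%N.
Proof.
move=> n2; have [L HL <-] := @ldim_attained _ (membership n).
have := leq_trans (card_membership_traces n) (card_down_traces (~: set_points n) HL).
rewrite card_setC_set_points; set t := mu L => bound.
(* If [n <= t], then [2 ^ n <= n ^ n] already suffices. *)
have [nt|tn] := leqP n t.
  apply: (@leq_trans (n ^ n)); first by rewrite leq_exp2r // ltnW.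
  by rewrite leq_exp2l //; lia.
(* As [t < n], [t * n.+1 <= n ^ 2 - 1], so the base [(n * t * n.+1).+1] is at most [n ^ 3]. *)
apply: leq_trans bound _; rewrite expnM.
case: (posnP t) => [-> //|t_gt0]; rewrite leq_exp2r //.
by rewrite -mulnA (expnS n 2) ltn_mul2l -mulnn; nia.
Qed.

(** * Choice of the chunk size and numerical estimates *)

Lemma muln_exp4_quarter m : (4 ^ (m %/ 4) * m <= 2 * 2 ^ m)%N.
Proof.
(* What [4 ^ (m %/ 4)] leaves of [2 ^ m] has exponent at least half of [m], enough to absorb the
   factor [m]. *)
have mq : (m <= 2 * (m - 2 * (m %/ 4)))%N by lia.
have qm : (2 * (m %/ 4) <= m)%N by lia.
have m2 : (m <= 2 * 2 ^ (m - 2 * (m %/ 4)))%N.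
  by apply: leq_trans mq _; rewrite leq_mul2l ltnW ?orbT // ltn_expl.
apply: leq_trans (leq_mul (leqnn _) m2) _.
have -> : (4 ^ (m %/ 4) = 2 ^ (2 * (m %/ 4)))%N by rewrite expnM.
by rewrite mulnCA -expnD subnKC.
Qed.

(** With [m = trunc_log 2 n] and [k = (m %/ 4).+1], the previous bound times [m] is [5 * m + 2 * (n
    %/ k * m) + 2 * (4 ^ k * m)], at most [5 * n + 8 * n + 16 * n]. *)
Lemma ldim_trunc_log d (P : finPOrderType d) (A : {set P}) n :
  antichain A -> #|~: A| = n -> (0 < n)%N -> (ldim P * trunc_log 2 n <= 29 * n)%N.
Proof.
move=> acA cA n0; have := trunc_logP (isT : 1 < 2)%N n0.
move: (trunc_log 2 n) => m n2m.
have mn : (m <= n)%N by apply: leq_trans (ltnW (ltn_expl m _)) n2m.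
have exp4 : (4 ^ (m %/ 4).+1 * m <= 8 * n)%N.
  have := muln_exp4_quarter m; rewrite expnS; move: (4 ^ _)%N (2 ^ m)%N n2m; nia.
have := ldim_antichain_add acA (ltn0Sn (m %/ 4)); rewrite cA.
have : (m <= 4 * (m %/ 4).+1)%N by lia.
move: (m %/ 4).+1 exp4 => k exp4 mk bound.
have quot : (n %/ k * m <= 4 * n)%N.
  apply: (@leq_trans (n %/ k * (4 * k))); first by rewrite leq_mul2l mk orbT.
  by rewrite mulnCA leq_mul2l leq_divM.
apply: leq_trans (leq_mul bound (leqnn m)) _.
move: (4 ^ k)%N (n %/ k)%N exp4 quot => a b exp4 quot.
by rewrite !mulnDl -!mulnA mulSn; lia.
Qed.

(** * Passage to natural logarithms *)

Local Open Scope ring_scope.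

Theorem theorem3p12 (R : realType) :
  exists c C : R,
    [/\ 0 < c,
        0 < C,
        forall (n : nat) (d : Order.disp_t) (P : finPOrderType d)
               (A : {set P}),
          (2 <= n)%N -> antichain A -> #|~: A| = n ->
          (ldim P)%:R <= C * (n%:R / ln n%:R)
      & exists N : nat, forall n : nat, (N <= n)%N ->
          exists (d : Order.disp_t) (P : finPOrderType d) (A : {set P}),
            [/\ antichain A, #|~: A| = n
              & c * (n%:R / ln n%:R) <= (ldim P)%:R]].
Proof.
have ln2_gt0 : 0 < ln (2 : R) by rewrite ln_gt0 // ltr1n.
have ln_gt0n n : (2 <= n)%N -> 0 < ln (n%:R : R) by move=> n2; rewrite ln_gt0 // ltr1n.
(* With [m = trunc_log 2 n], [ln n <= m.+1 * ln 2 <= m.+1 <= 2 * m], whence [58 = 2 * 29]. The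
   constant [ln 2 / 3] comes from taking logarithms in [2 ^ n <= n ^ (3 * t)]. *)
exists (ln 2 / 3), 58; split=> //; first by rewrite divr_gt0.
- move=> n d P A n2 acA cA; rewrite mulrA ler_pdivlMr ?ln_gt0n //.
  set m := trunc_log 2 n.
  have m_gt0 : (0 < m)%N by rewrite /m trunc_log_gt0.
  have ln_le : ln (n%:R : R) <= (2 * m)%:R.
    apply: (@le_trans _ _ (ln (2 ^+ m.+1))).
      rewrite ler_ln ?posrE ?exprn_gt0 ?ltr0n //; last exact: ltnW.
      by rewrite -natrX ler_nat ltnW // trunc_log_ltn.
    rewrite lnXn //.
    have ln2_le1 : ln (2 : R) <= 1.
      have -> : 2 = 1 + 1 :> R by [].
      by apply: le_ln1Dx; rewrite (lt_trans (ltrN10 R)) ?ltr01.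
    apply: (@le_trans _ _ (1 *+ m.+1)); first by rewrite lerMn2r.
    by rewrite ler_nat; lia.
  have := ldim_trunc_log acA cA (ltnW n2); rewrite -/m => bound.
  apply: le_trans (ler_wpM2l (ler0n _ _) ln_le) _.
  by rewrite -!natrM ler_nat; lia.
- exists 2%N => n n2; exists _, (membership n), (set_points n); split.
  + exact: antichain_set_points.
  + exact: card_setC_set_points.
  have := ldim_membership n2; set t := ldim _ => bound.
  rewrite mulrA ler_pdivrMr ?ln_gt0n // mulrAC ler_pdivrMr //.
  have : ln (2 ^+ n : R) <= ln (n%:R ^+ (3 * t)).
    rewrite ler_ln ?posrE ?exprn_gt0 ?ltr0n //; last exact: ltnW.
    by rewrite -!natrX ler_nat.
  rewrite !lnXn ?ltr0n //; last exact: ltnW.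
  by rewrite mulr_natr -[ln n%:R *+ _]mulr_natr natrM mulrCA mulrC [ln _ * t%:R]mulrC.
Qed.
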